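(* Let $G$ be a probability distribution on $[0,1]$ with moments $m_k=\mathbb{E}_{\alpha\sim G}[\alpha^k]$, let $R\ge1$ be an integer, and let $(\alpha_i,X_i)$, $i=1,\dots,N$, be i.i.d. with $\alpha_i\sim G$ and $X_i\mid\alpha_i\sim\mathrm{Bin}(R,\alpha_i)$; only the $X_i$ are observed. For every integer $1\le k\le R$, $$\widehat{m_k}=\frac1N\sum_{i=1}^N\binom{X_i}{k}\Big/\binom{R}{k}$$ is an unbiased estimator of $m_k$; hence the law of the data $\{X_i\}$ identifies $m_1,\dots,m_R$. Moreover, with $\rho_v=\frac{m_2-m_1^2}{m_1(1-m_1)}$, the estimator $$\widehat{\rho_v}=\frac{\widehat{m_2}-\widehat{m_1}^{\,2}}{\widehat{m_1}(1-\widehat{m_1})}$$ is a consistent estimator of $\rho_v$ as $N\to\infty$ already when $R=2$ (and for every $R\ge2$).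
   Context: ''Identifies'' means that $m_1,\dots,m_R$ are determined by the distribution of $X_1$. For the statement about $\rho_v$ it is assumed that $0<m_1<1$, so that $\rho_v$ is defined; $\rho_v=\mathrm{Var}(\alpha)/(\bar\alpha(1-\bar\alpha))$ with $\bar\alpha=m_1$ is the correlation between two verdicts that are conditionally i.i.d. Bernoulli$(\alpha)$ given $\alpha\sim G$. The number $X_i$ is the number of accepts among $R$ repeated verdicts of a verifier on the $i$-th erroneous instance. *)

(* Defs.v *)
From HB Require Import structures.
From mathcomp Require Import all_boot all_order all_algebra.
From mathcomp Require Import all_classical all_reals all_analysis.

Set Implicit Arguments.
Unset Strict Implicit.
Unset Printing Implicit Defensive.

Import Order.TTheory GRing.Theory Num.Theory.
Import numFieldNormedType.Exports.

Local Open Scope classical_set_scope.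
Local Open Scope ring_scope.

Section model.
Context {R : realType}.

Definition supported_on_unit_interval
    (G : probability (measurableTypeR R) R) : Prop :=
  G `[0, 1]%classic = 1%E.

Definition moment (G : probability (measurableTypeR R) R) (k : nat) : R :=
  \int[G]_a (a ^+ k).

Definition rho_v (G : probability (measurableTypeR R) R) : R :=
  (moment G 2 - moment G 1 ^+ 2) / (moment G 1 * (1 - moment G 1)).

Definition has_law (d d' : measure_display) (T : measurableType d)
    (T' : measurableType d') (P : probability T R) (Y : {RV P >-> T'})
    (mu : probability T' R) : Prop :=
  forall A : set T', measurable A -> distribution P Y A = mu A.

(* The conditional law of X given alpha is Bin(r, alpha), in the sense that
   w |-> binomial_prob r (alpha w) B is a version of P(X \in B | alpha):
   integrating it over any event {alpha \in A} gives P(alpha \in A, X \in B). *)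
Definition conditionally_binomial (d : measure_display) (T : measurableType d)
    (P : probability T R) (r : nat)
    (alpha : {RV P >-> measurableTypeR R}) (X : {RV P >-> nat}) : Prop :=
  forall (A : set (measurableTypeR R)) (B : set nat), measurable A ->
    P (alpha @^-1` A `&` X @^-1` B) =
    (\int[P]_(w in alpha @^-1` A) binomial_prob r (alpha w) B)%E.

Definition binomial_mixture (d : measure_display) (T : measurableType d)
    (P : probability T R) (G : probability (measurableTypeR R) R) (r : nat)
    (alpha : {RV P >-> measurableTypeR R}) (X : {RV P >-> nat}) : Prop :=
  has_law alpha G /\ conditionally_binomial r alpha X.

Definition independent_pairs (d : measure_display) (T : measurableType d)
    (P : probability T R) (N : nat)
    (alpha : 'I_N -> {RV P >-> measurableTypeR R})
    (X : 'I_N -> {RV P >-> nat}) : Prop :=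
  forall B : 'I_N -> set (measurableTypeR R * nat),
    (forall i, measurable (B i)) ->
    P [set w | forall i, B i (alpha i w, X i w)] =
    (\prod_(i < N) P [set w | B i (alpha i w, X i w)])%E.

(* Identical distribution of the pairs needs no separate clause: the law of
   (alpha i, X i) is determined by G and r. *)
Definition iid_sample (d : measure_display) (T : measurableType d)
    (P : probability T R) (G : probability (measurableTypeR R) R) (r N : nat)
    (alpha : 'I_N -> {RV P >-> measurableTypeR R})
    (X : 'I_N -> {RV P >-> nat}) : Prop :=
  (forall i, binomial_mixture G r (alpha i) (X i)) /\
  independent_pairs alpha X.

Definition m_hat (r k N : nat) (x : 'I_N -> nat) : R :=
  N%:R^-1 * \sum_(i < N) 'C(x i, k)%:R / 'C(r, k)%:R.

(* The estimator is undefined when m_hat r 1 x is 0 or 1; it is then 0 here,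
   since x / 0 = 0. *)
Definition rho_hat (r N : nat) (x : 'I_N -> nat) : R :=
  (m_hat r 2 x - m_hat r 1 x ^+ 2) / (m_hat r 1 x * (1 - m_hat r 1 x)).

End model.

(* Main.v *)
(* On [0,1] the identity sum_j 'C(j,k) Bin(r,a){j} = 'C(r,k) a^k integrates
   against G to m_k = sum_j 'C(j,k)/'C(r,k) P(X = j), which gives both
   unbiasedness and identification.  The summands of m_hat - m_k are independent,
   centered and bounded, so the second moment of their sum is O(N) and Chebyshev's
   inequality gives P(|m_hat - m_k| >= delta) = O(1/N).  Consistency of rho_hat
   follows since rho is a continuous function of (m_1, m_2) at m_1 in ]0,1[. *)

Require Import Defs.
From HB Require Import structures.
From mathcomp Require Import all_boot all_order all_algebra.
From mathcomp Require Import all_classical all_reals all_analysis.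
From mathcomp Require Import measurable_realfun.
From mathcomp Require Import ring lra zify.

Set Implicit Arguments.
Unset Strict Implicit.
Unset Printing Implicit Defensive.

Import Order.TTheory GRing.Theory Num.Theory.
Import numFieldNormedType.Exports.

Local Open Scope classical_set_scope.
Local Open Scope ring_scope.

(** * Trinomial revision and the factorial moments of the binomial law *)

Lemma mul_bin_bin (n k i : nat) : (k + i <= n)%N ->
  ('C(n, k + i) * 'C(k + i, k) = 'C(n, k) * 'C(n - k, i))%N.
Proof.
move=> kin; have kn : (k <= n)%N := leq_trans (leq_addr _ _) kin.
have ink : (i <= n - k)%N by rewrite leq_subRL.
have := bin_fact kin; have := bin_fact (leq_addr i k).
have := bin_fact ink; have := bin_fact kn.
(* This equates two factorisations of [n!], one through [(k + i)!] and one through [(n - k)!]; the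
   common positive factorials are then cancelled. *)
rewrite addKn subnDA => <- <- <-.
have := fact_gt0 k; have := fact_gt0 i; have := fact_gt0 (n - k - i).
move: 'C(n, k + i) 'C(k + i, k) 'C(n, k) 'C(n - k, i) => a b c e.
move: k`! i`! (n - k - i)`! => x y z z0 y0 x0 h.
by apply/eqP; rewrite -(eqn_pmul2r z0) -(eqn_pmul2r y0) -(eqn_pmul2r x0);
  apply/eqP; lia.
Qed.

(** The terms with [j < k] vanish. After the shift [j = i + k], trinomial revision pulls out
    ['C(r, k) * a ^+ k] and leaves the binomial expansion of [((1 - a) + a) ^+ (r - k) = 1]. This is
    a polynomial identity, valid for every real [a]. *)
Lemma sum_bin_binomial_pmf (R : realType) (r k : nat) (a : R) : (k <= r)%N ->
  \sum_(j < r.+1) 'C(j, k)%:R * binomial_pmf r a j = 'C(r, k)%:R * a ^+ k.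
Proof.
move=> kr.
rewrite -(big_mkord xpredT (fun j => 'C(j, k)%:R * binomial_pmf r a j)).
rewrite (big_cat_nat (n := k)) ?leqW//= big_nat_cond big1 ?add0r; last first.
  by move=> j /andP[/andP[_ jk] _]; rewrite bin_small// mul0r.
rewrite -{1}[k]add0n big_addn subSn// big_mkord.
have -> : 'C(r, k)%:R * a ^+ k =
    'C(r, k)%:R * a ^+ k * ((1 - a) + a) ^+ (r - k).
  by rewrite subrK expr1n mulr1.
rewrite exprDn mulr_sumr; apply: eq_bigr => i _; rewrite /binomial_pmf.
have kir : (k + i <= r)%N by rewrite -leq_subRL// -ltnS.
rewrite [(i + k)%N]addnC exprD subnDA /unstable.onem -!(mulr_natr (_ * _)).
transitivity (('C(r, k + i) * 'C(k + i, k))%:R *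
    (a ^+ k * a ^+ i * (1 - a) ^+ (r - k - i))).
  rewrite natrM.
  move: ('C(r, _)%:R : R) ('C(k + i, k)%:R : R) (a ^+ k) (a ^+ i).
  by move: ((1 - a) ^+ _) => *; ring.
rewrite mul_bin_bin// natrM.
move: ('C(r, _)%:R : R) ('C(_, i)%:R : R) (a ^+ k) (a ^+ i).
by move: ((1 - a) ^+ _) => *; ring.
Qed.

(** * Measurability of functions of the counts, and integrals of simple sums *)

Section finitely_many_counts.
Context {d : measure_display} {T : measurableType d} {R : realType}.
Context (P : probability T R).

(* Only countably many tuples of counts exist, so no regularity of Q is needed. *)
Lemma measurable_counts (N : nat) (X : 'I_N -> {RV P >-> nat})
    (Q : ('I_N -> nat) -> Prop) :
  measurable [set w | Q (fun i => X i w)].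
Proof.
have -> : [set w | Q (fun i => X i w)] =
    \bigcup_(x in [set x : {ffun 'I_N -> nat} | Q x])
      \bigcap_(i in [set: 'I_N]) (X i @^-1` [set x i]).
  apply/seteqP; split => w /=.
    move=> Qw; exists [ffun i => X i w] => /=.
      by move: Qw; congr (Q _); apply/funext => i; rewrite ffunE.
    by move=> i _ /=; rewrite ffunE.
  move=> [x /= Qx xw]; rewrite (_ : (fun i => X i w) = x)//.
  by apply/funext => i; apply: xw.
rewrite bigcup_mkcond.
apply: countable_bigcupT_measurable; first exact: countableP.
move=> x; case: ifP => // _.
apply: fin_bigcap_measurable; first exact: finite_finset.
by move=> i _; apply: measurable_funPTI.
Qed.

Lemma measurable_fun_counts (N : nat) (X : 'I_N -> {RV P >-> nat})
    (d' : measure_display) (U : measurableType d') (F : ('I_N -> nat) -> U) :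
  measurable_fun [set: T] (fun w => F (fun i => X i w)).
Proof.
by move=> _ Y _; rewrite setTI; exact: (measurable_counts X (fun x => Y (F x))).
Qed.

Lemma integrable_simple_sum (I : finType) (c : I -> R) (A : I -> set T) :
  (forall i, measurable (A i)) ->
  P.-integrable setT (fun w => (\sum_i c i * \1_(A i) w)%:E).
Proof.
move=> mA; under eq_fun do rewrite -sumEFin.
apply: integrable_sum => // i _; under eq_fun do rewrite EFinM.
by apply: integrableZl => //; apply: integrable_indic.
Qed.

Lemma integral_simple_sum (I : finType) (c : I -> R) (A : I -> set T) :
  (forall i, measurable (A i)) ->
  (\int[P]_w (\sum_i c i * \1_(A i) w)%:E =
   (\sum_i c i * fine (P (A i)))%:E)%E.
Proof.
move=> mA; under eq_integral do rewrite -sumEFin.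
rewrite integral_sum//; last first.
  move=> i; under eq_fun do rewrite EFinM.
  by apply: integrableZl => //; apply: integrable_indic.
rewrite -sumEFin; apply: eq_bigr => i _.
under eq_integral do rewrite EFinM.
rewrite integralZl//; last exact: integrable_indic.
by rewrite integral_indic// setIT EFinM fineK// fin_num_measure.
Qed.
End finitely_many_counts.

(** * The law of one count as a mixture over [G] *)

Section binomial_mixture_law.
Context {R : realType} {G : probability (measurableTypeR R) R}.
Context (G01 : supported_on_unit_interval G).

Let m01 : measurable (`[0, 1]%classic : set (measurableTypeR R)).
Proof. exact: measurable_itv. Qed.

Let G01C : G (~` `[0, 1]%classic) = 0%E.
Proof. by rewrite probability_setC// G01 -EFinB subrr. Qed.

Lemma integrable_bounded01 (f : R -> R) (M : R) :
  measurable_fun [set: R] f -> (forall a, 0 <= a <= 1 -> `|f a| <= M) ->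
  G.-integrable `[0, 1]%classic (fun a => (f a)%:E).
Proof.
move=> mf fM; apply: measurable_bounded_integrable => //.
- by rewrite (le_lt_trans (probability_le1 _ _))// ltry.
- exact: measurable_funTS.
exists M; split; first exact: num_real.
by move=> x Mx a /= /[!in_itv]/= a01; apply: le_trans (ltW Mx); exact: fM.
Qed.

(** The complement of the unit interval is [G]-null, and on the interval powers are bounded by 1.
    Hence the integral is finite and the [fine] hidden in [moment] loses nothing. *)
Lemma moment_itv01 (k : nat) :
  ((moment G k)%:E = \int[G]_(a in `[0%R, 1%R]) (a ^+ k)%:E)%E.
Proof.
have mX : measurable_fun [set: R] (EFin \o (fun a : R => a ^+ k)).
  by apply/measurable_EFinP; exact: measurable_funX.
have iX : G.-integrable `[0, 1]%classic (fun a : R => (a ^+ k)%:E).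
  apply: (@integrable_bounded01 _ 1); first exact: measurable_funX.
  by move=> a /andP[a0 a1]; rewrite ger0_norm ?exprn_ge0// exprn_ile1.
have iT : G.-integrable setT (fun a : R => (a ^+ k)%:E).
  apply/(negligible_integrable (measurableC m01) measurableT mX G01C).
  by rewrite setTD setCK.
rewrite /moment /Rintegral fineK; last exact: integrable_fin_num.
rewrite (negligible_integral (measurableC m01) measurableT iT G01C).
by rewrite setTD setCK.
Qed.

Context {d : measure_display} {T : measurableType d} {P : probability T R}.
Context {r : nat} {alpha : {RV P >-> measurableTypeR R}} {X : {RV P >-> nat}}.
Context (mix : binomial_mixture G r alpha X).

(** Taking the whole line as the event for [alpha] in the conditional law removes the conditioning;
    the integral over [P] is then transported to [G] along [alpha]. Restricting to the unit interval
    selects the branch of [binomial_prob] where the parameter is a genuine success probability. *)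
Lemma binomial_mixture_prob (B : set nat) :
  (P (X @^-1` B) =
   \int[G]_(a in `[0%R, 1%R]) \esum_(k in B) (binomial_pmf r a k)%:E)%E.
Proof.
have [law /(_ setT B measurableT)] := mix.
have mb :
    measurable_fun [set: measurableTypeR R] (fun a => binomial_prob r a B).
  exact: (measurable_kernel (kprobability (@measurable_binomial_prob R r)) B).
rewrite preimage_setT setTI => ->.
rewrite -(ge0_integral_distribution alpha mb); last first.
  by move=> a; exact: measure_ge0.
rewrite (eq_measure_integral G); last by move=> A mA _; exact: law.
rewrite (ge0_negligible_integral _ _ mb _ G01C)//; last exact: measurableC.
rewrite setTD setCK; apply: eq_integral => a /[!inE]/= /[!in_itv]/= a01.
by rewrite /binomial_prob a01.
Qed.

Lemma binomial_mixture_pmf (j : nat) :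
  P (X @^-1` [set j]) = (\int[G]_(a in `[0%R, 1%R]) (binomial_pmf r a j)%:E)%E.
Proof.
rewrite binomial_mixture_prob.
apply: eq_integral => a /[!inE]/= /[!in_itv]/= a01.
by rewrite esum_set1// lee_fin binomial_pmf_ge0.
Qed.

Lemma binomial_mixture_le : P (X @^-1` [set j | (r < j)%N]) = 0%E.
Proof.
rewrite binomial_mixture_prob integral0_eq// => a _.
by rewrite esum1// => j /= rj; rewrite /binomial_pmf bin_small.
Qed.

(** The right-hand side depends on the law of [X] alone, so it serves both identification and the
    centering of the summands. It is the factorial moment identity integrated against [G]; the sum
    is finite, so it commutes with the integral. *)
Lemma moment_pmf (k : nat) : (k <= r)%N ->
  moment G k =
  \sum_(j < r.+1) 'C(j, k)%:R / 'C(r, k)%:R *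
    fine (P (X @^-1` [set (j : nat)])).
Proof.
move=> kr; apply: EFin_inj; rewrite moment_itv01 -sumEFin.
have mp j := @measurable_binomial_pmf R setT r j.
have ip (j : 'I_r.+1) :
    G.-integrable `[0, 1]%classic (fun a => (binomial_pmf r a j)%:E).
  (* The bound comes from [a ^+ j * (1 - a) ^+ (r - j) <= 1] on the unit interval. *)
  apply: (@integrable_bounded01 _ ('C(r, j)%:R)) => // a /andP[a0 a1].
  rewrite ger0_norm ?binomial_pmf_ge0 ?a0// /binomial_pmf ler_wMn2r//.
  have [b0 b1] : 0 <= 1 - a /\ 1 - a <= 1 by split; lra.
  by rewrite /unstable.onem mulr_ile1 ?exprn_ge0 ?exprn_ile1.
transitivity (\sum_(j < r.+1) \int[G]_(a in `[0%R, 1%R])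
    (('C(j, k)%:R / 'C(r, k)%:R)%:E * (binomial_pmf r a j)%:E))%E.
  rewrite -integral_sum//; last by move=> j; exact: integrableZl.
  apply: eq_integral => a _; under eq_bigr do rewrite -EFinM.
  rewrite sumEFin; congr EFin; under eq_bigr do rewrite mulrAC.
  rewrite -mulr_suml sum_bin_binomial_pmf// mulrAC mulfV ?mul1r//.
  by rewrite pnatr_eq0 -lt0n bin_gt0.
apply: eq_bigr => j _; rewrite integralZl// [in RHS]EFinM -binomial_mixture_pmf.
by rewrite fineK// fin_num_measure//; exact: measurable_funPTI.
Qed.

(** This is the case [k = 0] of [moment_pmf], the zeroth moment being the total mass of [G]. *)
Lemma sum_binomial_mixture_pmf :
  \sum_(j < r.+1) fine (P (X @^-1` [set (j : nat)])) = 1.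
Proof.
transitivity (moment G 0).
  by rewrite (@moment_pmf 0)//; apply: eq_bigr => j _; rewrite !bin0 divr1 mul1r.
apply: EFin_inj; rewrite moment_itv01.
under eq_integral do rewrite expr0.
by rewrite integral_cst// mul1e.
Qed.
End binomial_mixture_law.

(** * Integrals of functions of the counts that vanish beyond [r] *)

Section counts_supported_below.
Context {d : measure_display} {T : measurableType d} {R : realType}.
Context {P : probability T R} {r : nat}.

(** If [X w] exceeds [r], both sides are 0; otherwise exactly one indicator is 1. Integrals thereby
    reduce to finite sums over atoms. *)
Lemma supported_countE (X : {RV P >-> nat}) (h : nat -> R) (w : T) :
  (forall j, (r < j)%N -> h j = 0) ->
  h (X w) = \sum_(j < r.+1) h j * \1_(X @^-1` [set (j : nat)]) w.
Proof.
move=> h0; have [rX|] := ltnP r (X w).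
  rewrite h0// big1// => j _; rewrite indicE memNset ?mulr0//= => Xj.
  by move: rX; rewrite Xj ltnNge -ltnS ltn_ord.
rewrite -ltnS => Xr; rewrite (bigD1 (Ordinal Xr))//= indicE mem_set// mulr1.
rewrite big1 ?addr0// => j jX; rewrite indicE memNset ?mulr0//= => Xj.
by move/eqP: jX; apply; apply: val_inj.
Qed.

Lemma integrable_supported_count (X : {RV P >-> nat}) (h : nat -> R) :
  (forall j, (r < j)%N -> h j = 0) ->
  P.-integrable setT (fun w => (h (X w))%:E).
Proof.
move=> h0; under eq_fun do rewrite (supported_countE X _ h0).
by apply: integrable_simple_sum => j; exact: measurable_funPTI.
Qed.

Lemma integral_supported_count (X : {RV P >-> nat}) (h : nat -> R) :
  (forall j, (r < j)%N -> h j = 0) ->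
  (\int[P]_w (h (X w))%:E =
   (\sum_(j < r.+1) h j * fine (P (X @^-1` [set (j : nat)])))%:E)%E.
Proof.
move=> h0; under eq_integral do rewrite (supported_countE X _ h0).
by apply: integral_simple_sum => j; exact: measurable_funPTI.
Qed.

Let supported_count2E (X Y : {RV P >-> nat}) (h g : nat -> R) (w : T) :
  (forall j, (r < j)%N -> h j = 0) -> (forall j, (r < j)%N -> g j = 0) ->
  h (X w) * g (Y w) = \sum_(p : 'I_r.+1 * 'I_r.+1) h p.1 * g p.2 *
    \1_(X @^-1` [set (p.1 : nat)] `&` Y @^-1` [set (p.2 : nat)]) w.
Proof.
move=> h0 g0; rewrite (supported_countE X w h0) (supported_countE Y w g0).
rewrite big_distrlr pair_big/=; apply: eq_bigr => p _.
by rewrite mulrACA indicI.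
Qed.

Lemma integrable_supported_count2 (X Y : {RV P >-> nat}) (h g : nat -> R) :
  (forall j, (r < j)%N -> h j = 0) -> (forall j, (r < j)%N -> g j = 0) ->
  P.-integrable setT (fun w => (h (X w) * g (Y w))%:E).
Proof.
move=> h0 g0; under eq_fun do rewrite (supported_count2E X Y _ h0 g0).
apply: integrable_simple_sum => p.
by apply: measurableI; exact: measurable_funPTI.
Qed.

(** Both sides are finite double sums over pairs of atoms, so independence on singletons suffices
    for the product rule. *)
Lemma integral_supported_count2 (X Y : {RV P >-> nat}) (h g : nat -> R) :
  (forall j, (r < j)%N -> h j = 0) -> (forall j, (r < j)%N -> g j = 0) ->
  (forall a b, P (X @^-1` [set a] `&` Y @^-1` [set b]) =
     P (X @^-1` [set a]) * P (Y @^-1` [set b]))%E ->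
  (\int[P]_w (h (X w) * g (Y w))%:E =
   \int[P]_w (h (X w))%:E * \int[P]_w (g (Y w))%:E)%E.
Proof.
move=> h0 g0 indep; rewrite !integral_supported_count// -EFinM.
under eq_integral do rewrite (supported_count2E X Y _ h0 g0).
rewrite integral_simple_sum; last first.
  by move=> p; apply: measurableI; exact: measurable_funPTI.
congr EFin; rewrite big_distrlr pair_big/=; apply: eq_bigr => p _.
rewrite indep fineM ?fin_num_measure//; [|exact: measurable_funPTI..].
by rewrite mulrACA.
Qed.
End counts_supported_below.

(** * The i.i.d. sample: pairwise independence, unbiasedness and Chebyshev's bound *)

Section sample.
Context {R : realType} {G : probability (measurableTypeR R) R}.
Context (G01 : supported_on_unit_interval G).
Context {d : measure_display} {T : measurableType d} {P : probability T R}.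
Context {r N : nat} {alpha : 'I_N -> {RV P >-> measurableTypeR R}}.
Context {X : 'I_N -> {RV P >-> nat}} (iid : iid_sample G r alpha X).

Lemma iid_counts_indep (i j : 'I_N) (a b : nat) : i != j ->
  (P (X i @^-1` [set a] `&` X j @^-1` [set b]) =
   P (X i @^-1` [set a]) * P (X j @^-1` [set b]))%E.
Proof.
(* Joint independence is applied to events constraining only the counts [i] and [j]; every other
   factor has probability 1. *)
move=> ij; pose B (l : 'I_N) : set nat :=
  if l == i then [set a] else if l == j then [set b] else setT.
have [_ /(_ (fun l => setT `*` B l))] := iid.
have -> : [set w | forall l, (setT `*` B l) (alpha l w, X l w)] =
    X i @^-1` [set a] `&` X j @^-1` [set b].
  apply/seteqP; split=> w /=.
    move=> Bw; split; first by have [_] := Bw i; rewrite /B eqxx.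
    by have [_] := Bw j; rewrite /B eqxx eq_sym (negbTE ij).
  move=> [ia jb] l; split=> //; rewrite /B/=.
  by case: eqP => [->//|_]; case: eqP => [->//|].
move=> -> //; last by move=> l; exact: measurableX.
have E l : [set w | (setT `*` B l) (alpha l w, X l w)] = X l @^-1` B l.
  by apply/seteqP; split=> w //= [].
under eq_bigr do rewrite E.
rewrite (bigD1 i)//= (bigD1 j)//=; last by rewrite eq_sym.
rewrite big1 ?mule1; last first.
  move=> l /andP[li lj]; rewrite /B (negbTE li) (negbTE lj) preimage_setT.
  exact: probability_setT.
by rewrite /B !eqxx eq_sym (negbTE ij).
Qed.

(* Cut off at r, which X exceeds with probability 0, so that functions of the
   counts are finite combinations of indicators. *)
Definition centered_count (k j : nat) : R :=
  if (j <= r)%N then 'C(j, k)%:R / 'C(r, k)%:R - moment G k else 0.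

Let centered_count0 k j : (r < j)%N -> centered_count k j = 0.
Proof. by rewrite /centered_count ltnNge => /negbTE ->. Qed.

Let integrable_centered k i :=
  integrable_supported_count (X i) (centered_count0 k).

Let integrable_centered2 k i j :=
  integrable_supported_count2 (X i) (X j) (centered_count0 k)
    (centered_count0 k).

Lemma integral_centered_count (k : nat) (i : 'I_N) : (k <= r)%N ->
  (\int[P]_w (centered_count k (X i w))%:E = 0)%E.
Proof.
move=> kr; have [/(_ i) mix _] := iid.
rewrite (integral_supported_count _ (centered_count0 k)); congr EFin.
under eq_bigr => j _ do rewrite /centered_count -ltnS ltn_ord mulrBl.
rewrite sumrB -(moment_pmf G01 mix kr) -mulr_sumr.
by rewrite (sum_binomial_mixture_pmf G01 mix) mulr1 subrr.
Qed.

(** A crude bound on the second moment of one centered summand: the weights [P(X = j)] are replaced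
    by 1. What matters is that it does not depend on [N]. *)
Definition centered_count_bound (k : nat) : R :=
  \sum_(j < r.+1) centered_count k j ^+ 2.

Lemma integral_centered_count_sqr (k : nat) (i : 'I_N) :
  (\int[P]_w (centered_count k (X i w) * centered_count k (X i w))%:E <=
   (centered_count_bound k)%:E)%E.
Proof.
rewrite (@integral_supported_count _ _ _ _ r _
  (fun j => centered_count k j * centered_count k j)); last first.
  by move=> j /centered_count0 ->; rewrite mul0r.
rewrite lee_fin ler_sum// => j _; rewrite -expr2 ler_piMr ?sqr_ge0//.
by rewrite -lee_fin fineK ?fin_num_measure ?probability_le1//; exact: measurable_funPTI.
Qed.

(** In the expanded square the off-diagonal terms factor by independence and vanish by centering,
    which leaves [N] diagonal terms. *)
Lemma integral_sum_centered_count_sqr (k : nat) : (k <= r)%N ->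
  (\int[P]_w ((\sum_i centered_count k (X i w)) ^+ 2)%:E <=
   (N%:R * centered_count_bound k)%:E)%E.
Proof.
move=> kr.
under eq_integral => w _ do rewrite expr2 big_distrlr/= pair_big/= -sumEFin.
rewrite integral_sum; [|by []|by move=> p; exact: integrable_centered2].
rewrite -(pair_big xpredT xpredT (fun i j =>
  \int[P]_w (centered_count k (X i w) * centered_count k (X j w))%:E)%E)/=.
have -> : N%:R * centered_count_bound k = \sum_(i < N) centered_count_bound k.
  by rewrite sumr_const card_ord mulr_natl.
rewrite -sumEFin; apply: lee_sum => i _.
rewrite (bigD1 i)//= big1 ?adde0; first exact: integral_centered_count_sqr.
move=> j ji; rewrite (@integral_supported_count2 _ _ _ _ r)//.
- by rewrite integral_centered_count// mul0e.
- exact: centered_count0.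
- exact: centered_count0.
- by move=> a b; apply: iid_counts_indep; rewrite eq_sym.
Qed.

Lemma ae_counts_le : \forall w \ae P, forall i, (X i w <= r)%N.
Proof.
apply: filter_forall => i; have [/(_ i) mix _] := iid.
exists (X i @^-1` [set j | (r < j)%N]); split.
- exact: measurable_funPTI.
- by rewrite (binomial_mixture_le G01 mix).
- by move=> w /= /negP; rewrite -ltnNge.
Qed.

Lemma m_hat_centered (k : nat) (x : 'I_N -> nat) : (1 <= N)%N ->
  (forall i, (x i <= r)%N) ->
  m_hat r k x = moment G k + N%:R^-1 * \sum_i centered_count k (x i).
Proof.
move=> N0 xr; rewrite /m_hat.
under [in RHS]eq_bigr => i _ do rewrite /centered_count xr.
rewrite sumrB sumr_const card_ord mulrBr -[moment G k *+ N]mulr_natl mulrA.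
rewrite mulVf ?mul1r ?pnatr_eq0 -?lt0n//.
by rewrite addrC subrK.
Qed.

(** The centered form of [m_hat] holds only where all counts are at most [r], hence almost
    everywhere; it is substituted under the integral, where the centered part contributes 0. *)
Lemma expectation_m_hat (k : nat) : (1 <= N)%N -> (k <= r)%N ->
  ('E_P[(fun w => m_hat r k (fun i => X i w))] = (moment G k)%:E)%E.
Proof.
move=> N0 kr; rewrite unlock.
rewrite (ae_eq_integral (fun w =>
  (moment G k + N%:R^-1 * \sum_i centered_count k (X i w))%:E))//.
- under eq_integral do rewrite EFinD EFinM -sumEFin.
  have isum : P.-integrable setT (fun w => \sum_i (centered_count k (X i w))%:E)%E.
    by apply: integrable_sum => // i _; exact: integrable_centered.
  rewrite integralD//=; last 2 first.
  + exact: finite_measure_integrable_cst.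
  + exact: integrableZl.
  rewrite integral_cst// [X in (_ * X + _)%E]probability_setT mule1 integralZl// integral_sum//.
  by rewrite big1 ?mule0 ?adde0// => i _; exact: integral_centered_count.
- by apply/measurable_EFinP; exact: (measurable_fun_counts X (@m_hat R r k N)).
- apply/measurable_EFinP.
  exact: (measurable_fun_counts X
    (fun x => moment G k + N%:R^-1 * \sum_i centered_count k (x i))).
- by apply: filterS ae_counts_le => w Xr _; rewrite m_hat_centered.
Qed.

Lemma m_hat_tail (k : nat) (delta : R) : (1 <= N)%N -> (k <= r)%N -> 0 < delta ->
  (P [set w | (delta <= `|m_hat r k (fun i => X i w) - moment G k|)%R] <=
   (centered_count_bound k / delta ^+ 2 / N%:R)%:E)%E.
Proof.
move=> N0 kr d0; pose S w := \sum_i centered_count k (X i w).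
have N0' : 0 < N%:R :> R by rewrite ltr0n.
have mS : measurable_fun [set: T] S.
  exact: (measurable_fun_counts X (fun x => \sum_i centered_count k (x i))).
(* Chebyshev's inequality by hand: the square of [N%:R * delta] times the indicator of [B] is at
   most the square of [S]. *)
pose B := [set w | N%:R * delta <= `|S w|].
have mB : measurable B.
  exact: (measurable_counts X
    (fun x => N%:R * delta <= `|\sum_i centered_count k (x i)|)).
have PB : (((N%:R * delta) ^+ 2)%:E * P B <= (N%:R * centered_count_bound k)%:E)%E.
  apply: le_trans (integral_sum_centered_count_sqr kr).
  rewrite -{1}(setIT B) -integral_indic// -integralZl//; last exact: integrable_indic.
  apply: ge0_le_integral => //.
  - by move=> w _; rewrite -EFinM lee_fin mulr_ge0 ?sqr_ge0.
  - by apply: measurable_funeM; apply/measurable_EFinP; exact: measurable_indic.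
  - by apply/measurable_EFinP; exact: measurable_funX.
  - move=> w _; rewrite -EFinM lee_fin indicE.
    have [/set_mem Bw|_] := boolP (w \in B); last by rewrite mulr0 sqr_ge0.
    rewrite mulr1 -[leRHS]real_normK ?num_real// ler_pXn2r ?nnegrE//.
    by rewrite mulr_ge0 ?ltW.
(* [M] is a null set containing every point where some count exceeds [r]; off [M] the deviation
   event lies in [B]. *)
have [M [mM PM XM]] := ae_counts_le.
apply: (@le_trans _ _ (P (B `|` M))).
  apply: le_measure; rewrite ?inE.
  - exact: (measurable_counts X
      (fun x => delta <= `|m_hat r k x - moment G k|)).
  - exact: measurableU.
  - move=> w /= dw; have [Mw|Mw] := pselect (M w); [by right|left].
    have Xr : forall i, (X i w <= r)%N by apply: contrapT => Xr; exact/Mw/XM.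
    move: dw; rewrite m_hat_centered// addrC addKr normrM gtr0_norm ?invr_gt0//.
    by rewrite mulrC ler_pdivlMr// mulrC.
apply: le_trans (measureU2 _ mB mM) _; rewrite [X in (_ + X <= _)%E]PM adde0.
rewrite -(@lee_pmul2l _ ((N%:R * delta) ^+ 2)%:E)//; last first.
  by rewrite lte_fin exprn_gt0// mulr_gt0.
apply: le_trans PB _; rewrite -EFinM lee_fin le_eqVlt; apply/orP; left; apply/eqP.
by field; rewrite !gt_eqF.
Qed.
End sample.

(** * Continuity of the correlation in the first two moments, and the conclusion *)

(** The denominator is nonzero at [m1], so the total inverse is continuous there, and its default
    value at 0 needs no separate case. The weak inequality in the conclusion is the exact complement
    of the strict deviation event in the consistency claim. *)
Lemma continuous_rho (R : realType) (m1 m2 eps : R) : 0 < m1 < 1 -> 0 < eps ->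
  exists2 delta, 0 < delta &
    forall x y, `|x - m1| < delta -> `|y - m2| < delta ->
    `|(y - x ^+ 2) / (x * (1 - x)) - (m2 - m1 ^+ 2) / (m1 * (1 - m1))| <= eps.
Proof.
move=> /andP[m0 m1lt1] e0.
have : (fun p : R * R => (p.2 - p.1 ^+ 2) * (p.1 * (1 - p.1))^-1) @ (m1, m2) -->
    (m2 - m1 ^+ 2) * (m1 * (1 - m1))^-1.
  have c1 : (fun p : R * R => p.1) @ (m1, m2) --> m1 by exact: cvg_fst.
  have c2 : (fun p : R * R => p.2) @ (m1, m2) --> m2 by exact: cvg_snd.
  apply: cvgM.
    by apply: cvgB => //; rewrite !expr2; exact: cvgM.
  apply: cvgV; first by rewrite mulf_neq0// gt_eqF// subr_gt0.
  by apply: cvgM => //; apply: cvgB => //; exact: cvg_cst.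
move=> /cvgrPdist_le/(_ _ e0)/nbhs_ballP[delta /= d0 dB].
exists delta => // x y xd yd; rewrite distrC; apply: (dB (x, y)).
by split; rewrite /= /ball/= distrC.
Qed.

Theorem proposition5p1 (R : realType) (r : nat) (hr : (1 <= r)%N)
    (G : probability (measurableTypeR R) R)
    (hG : supported_on_unit_interval G) :
  [/\ (* unbiasedness *)
      forall (k N : nat), (1 <= k <= r)%N -> (1 <= N)%N ->
      forall (d : measure_display) (T : measurableType d)
        (P : probability T R)
        (alpha : 'I_N -> {RV P >-> measurableTypeR R})
        (X : 'I_N -> {RV P >-> nat}),
        iid_sample G r alpha X ->
        ('E_P[(fun w => m_hat r k (fun i => X i w))] = (moment G k)%:E)%E,
      (* identification of the moments by the law of one observation *)
      forall (G' : probability (measurableTypeR R) R),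
        supported_on_unit_interval G' ->
      forall (d d' : measure_display)
        (T : measurableType d) (T' : measurableType d')
        (P : probability T R) (P' : probability T' R)
        (alpha : {RV P >-> measurableTypeR R}) (X : {RV P >-> nat})
        (alpha' : {RV P' >-> measurableTypeR R}) (X' : {RV P' >-> nat}),
        binomial_mixture G r alpha X ->
        binomial_mixture G' r alpha' X' ->
        (forall B : set nat, distribution P X B = distribution P' X' B) ->
        forall k : nat, (1 <= k <= r)%N -> moment G k = moment G' k
    & (* consistency; the sample of each size N may live on its own space *)
      (2 <= r)%N -> 0 < moment G 1 < 1 ->
      forall (d : nat -> measure_display)
        (T : forall N : nat, measurableType (d N))
        (P : forall N : nat, probability (T N) R)
        (alpha : forall N : nat, 'I_N -> {RV (P N) >-> measurableTypeR R})
        (X : forall N : nat, 'I_N -> {RV (P N) >-> nat}),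
        (forall N : nat, iid_sample G r (alpha N) (X N)) ->
        forall eps : R, 0 < eps ->
        (fun N : nat =>
           P N [set w | eps < `|rho_hat r (fun i => X N i w) - rho_v G|])
          @ \oo --> 0%E ].
Proof.
split.
- move=> k N /andP[_ kr] N0 d T P alpha X iid.
  exact: (expectation_m_hat hG iid N0 kr).
- move=> G' hG' d d' T T' P P' alpha X alpha' X' mix mix' XX' k /andP[_ kr].
  rewrite (moment_pmf hG mix kr) (moment_pmf hG' mix' kr).
  apply: eq_bigr => j _; have := XX' [set (j : nat)].
  by rewrite /distribution /pushforward => ->.
move=> r2 m01 d T P alpha X iid eps e0.
have [delta d0 drho] := continuous_rho (moment G 2) m01 e0.
(* [c / N%:R] is the sum of the two Chebyshev bounds, for the first and the second empirical
   moment. *)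
pose c := (@centered_count_bound R G r 1 + @centered_count_bound R G r 2) /
  delta ^+ 2.
have cvg0 : (fun N : nat => (c / N%:R)%:E) @ \oo --> 0%E.
  apply: cvg_EFin; first exact: nearW.
  rewrite -(mulr0 c); apply: cvgM; first exact: cvg_cst.
  apply/gtr0_cvgV0; last exact: cvgr_idn.
  by exists 1%N => // N /= N0; rewrite ltr0n.
apply: (squeeze_cvge _ (cvg_cst 0%E) cvg0).
exists 1%N => // N /= N0; rewrite measure_ge0/=.
pose A k := [set w | delta <= `|m_hat r k (fun i => X N i w) - moment G k|].
have mA k : measurable (A k).
  exact: (measurable_counts (X N)
    (fun x => delta <= `|m_hat r k x - moment G k|)).
apply: (@le_trans _ _ (P N (A 1%N `|` A 2%N))).
  apply: le_measure; rewrite ?inE.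
  - exact: (measurable_counts (X N)
      (fun x => eps < `|rho_hat r x - rho_v G|)).
  - exact: measurableU.
  (* By contraposition: if both empirical moments are within [delta] of their targets, [drho] keeps
     [rho_hat] within [eps] of [rho_v]. *)
  - move=> w /=; apply: contraPP => /not_orP[/negP]; rewrite -ltNge => A1 /negP.
    by rewrite -ltNge => A2; apply/negP; rewrite -leNgt; exact: drho.
apply: le_trans (measureU2 _ (mA 1%N) (mA 2%N)) _.
rewrite /c !mulrDl EFinD; apply: leeD.
- exact: (m_hat_tail hG (iid N) N0 hr d0).
- exact: (m_hat_tail hG (iid N) N0 r2 d0).
Qed.
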